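(* Let $a,b\in\mathbb{R}$ with $b\neq 0$, let $\Lambda=b\,Y_1\wedge Y_2+2b\,Y_2\wedge Y_3+a\,Y_3\wedge Y_1$ on $\mathbb{R}^3$, and let $\mathcal{R}\subset\mathcal{P}$ be the complexes of formal (real) cochains and of potential cochains, both with differential $[\Lambda,\cdot]$. The $0$-cohomology spaces of $\mathcal{P}$ and $\mathcal{R}$ coincide: (i) if $a\neq 0$, then $H^0(\mathcal{P})=H^0(\mathcal{R})=H^0_{2,3}(\mathcal{P})=H^0_{2,3}(\mathcal{R})=\mathbb{R}$; (ii) if $a=0$, then $H^0(\mathcal{P})=H^0(\mathcal{R})=\bigoplus_{k=1}^{\infty}H^0_{2k,3k}(\mathcal{P})=\bigoplus_{k=1}^{\infty}H^0_{2k,3k}(\mathcal{R})=\bigoplus_{m=0}^{\infty}\mathbb{R}\,D^m$, where $D=(x_1^2+x_2^2)x_3$. (Infinite $\bigoplus$ over degrees denotes formal, possibly infinite, sums.)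
   Context: Coordinates $x_1,x_2,x_3$ on $\mathbb{R}^3$, $\partial_i=\partial/\partial x_i$, $\partial_{ij}=\partial_i\wedge\partial_j$. $Y_1=x_1\partial_1+x_2\partial_2$, $Y_2=x_1\partial_2-x_2\partial_1$, $Y_3=x_3\partial_3$ (pairwise commuting), $Y_{ij}=Y_i\wedge Y_j$, $Y_{123}=Y_1\wedge Y_2\wedge Y_3$. Set $D'=x_1^2+x_2^2$, $D=D'x_3$. $\Lambda$ is a Poisson tensor. For $0\le k\le r$: $P_{kr}=\mathrm{span}_{\mathbb{R}}\{x_1^{\ell}x_2^{k-\ell}x_3^{r-k}:0\le\ell\le k\}$ and $Q_{kr}=\frac1D P_{kr}$. $\Delta_{ij}=1-\delta_{ij}$ (Kronecker symbol); a factor $\Delta=0$ means the summand is absent. Potential cochain spaces (zero for other values of $k,r$): $\mathcal{P}^0_{kr}=Q_{kr}$ ($k\ge2$, $r\ge 3$, $k\le r-1$); $\mathcal{P}^1_{kr}=\Delta_{kr}Q_{kr}Y_1+\Delta_{kr}Q_{kr}Y_2+\Delta_{k1}Q_{kr}Y_3$ ($k\ge1$, $r\ge2$, $k\le r$); $\mathcal{P}^2_{kr}=\Delta_{k0}Q_{kr}Y_{23}+\Delta_{k0}Q_{kr}Y_{31}+\Delta_{kr}Q_{kr}Y_{12}$ ($k\ge0$, $r\ge1$, $k\le r$); $\mathcal{P}^3_{kr}=Q_{kr}Y_{123}$ ($0\le k\le r$). Real cochain spaces (subspaces of the preceding, same ranges of $k,r$): $\mathcal{R}^0_{kr}=P_{k-2,r-3}$;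 $\mathcal{R}^1_{kr}=\Delta_{kr}P_{k-1,r-2}\partial_1+\Delta_{kr}P_{k-1,r-2}\partial_2+\Delta_{k1}P_{k-2,r-2}\partial_3$; $\mathcal{R}^2_{kr}=\Delta_{k0}P_{k-1,r-1}\partial_{23}+\Delta_{k0}P_{k-1,r-1}\partial_{31}+\Delta_{kr}P_{k,r-1}\partial_{12}$; $\mathcal{R}^3_{kr}=P_{kr}\,\partial_1\wedge\partial_2\wedge\partial_3$. $\mathcal{P}=\bigoplus_{d,k,r}\mathcal{P}^d_{kr}$ and $\mathcal{R}=\bigoplus_{d,k,r}\mathcal{R}^d_{kr}$, where infinite sums over $(k,r)$ are formal (i.e. direct products), so that $\mathcal{R}^d$ is the space of all $d$-vector fields with coefficients in $\mathbb{R}[[x_1,x_2,x_3]]$. The differential on both is the Lichnerowicz–Poisson operator $[\Lambda,\cdot]$ (Schouten bracket): with $X_1=bY_2-aY_3$, $X_2=2bY_3-bY_1$, $X_3=aY_1-2bY_2$, it is $[\Lambda,f\mathbf{Y}]=\big(\sum_{i=1}^3X_i(f)Y_i\big)\wedge\mathbf{Y}$ for $\mathbf{Y}$ a wedge product of the $Y_i$. It preserves $k$ and $r$; $H^d_{kr}$ denotes the degree-$d$ cohomology of the $(k,r)$-part. $H(\mathcal{R})$ is the formal Poisson cohomology of $\Lambda$. Writing a cohomology space as a space of cochains means that these cochains are cocycles and that each class has exactly one representative in that space; ''coincide'' means that the inclusion $\mathcal{R}\subset\mathcal{P}$ induces an isomorphism in this cohomological degree. *)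

(* Defs.v *)
From HB Require Import structures.
From mathcomp Require Import all_boot all_order all_algebra.
From mathcomp Require Import mpoly.
From mathcomp Require Import classical_sets functions reals.

Set Implicit Arguments.
Unset Strict Implicit.
Unset Printing Implicit Defensive.

Import GRing.Theory.
Local Open Scope classical_set_scope.
Local Open Scope quotient_scope.
Local Open Scope ring_scope.

Notation ratfun R := {fraction {mpoly R[3]}}.

(* Multivector fields on R^3 with rational coefficients: [u I] is the
   coefficient of the wedge product, in increasing order, of the
   coordinate fields d/dx_i with i in I.  All degrees live in one space. *)
Notation mvf R := {ffun {set 'I_3} -> (ratfun R)^o}.

(* The coordinates x_1, x_2, x_3 are the indeterminates of index 0, 1, 2. *)
Definition i1 : 'I_3 := @Ordinal 3 0 isT.
Definition i2 : 'I_3 := @Ordinal 3 1 isT.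
Definition i3 : 'I_3 := @Ordinal 3 2 isT.

Definition coord (R : realType) (i : 'I_3) : ratfun R := tofrac ('X_i).
Definition rconst (R : realType) (c : R) : ratfun R := tofrac (c%:MP).

(* The quotient rule, applied to the representative n / d of f chosen by
   [repr]; the result does not depend on that choice. *)
Definition pderiv (R : realType) (i : 'I_3) (f : ratfun R) : ratfun R :=
  let n := (frac (repr f)).1 in
  let d := (frac (repr f)).2 in
  tofrac (n^`M(i) * d - n * d^`M(i)) / tofrac d ^+ 2.

Definition basis (R : realType) (I : {set 'I_3}) : mvf R :=
  [ffun J : {set 'I_3} => (J == I)%:R].

(* Sign of the permutation sorting "I in increasing order, then J". *)
Definition shuffle_sign (R : realType) (I J : {set 'I_3}) : ratfun R :=
  (-1) ^+ (\sum_(i in I) \sum_(j in J) (j < i)%N)%N.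

Definition wedge (R : realType) (u v : mvf R) : mvf R :=
  [ffun I : {set 'I_3} => \sum_(J : {set 'I_3} | J \subset I)
     shuffle_sign R J (I :\: J) * u J * v (I :\: J)].

Definition coef_deriv (R : realType) (i : 'I_3) (u : mvf R) : mvf R :=
  [ffun I : {set 'I_3} => pderiv i (u I)].

(* Left and right derivatives with respect to the odd variable xi_i which
   stands for d/dx_i. *)
Definition lderiv (R : realType) (i : 'I_3) (u : mvf R) : mvf R :=
  [ffun I : {set 'I_3} => if i \in I then 0
             else shuffle_sign R [set i]%SET I * u (i |: I)%SET].
Definition rderiv (R : realType) (i : 'I_3) (u : mvf R) : mvf R :=
  [ffun I : {set 'I_3} => if i \in I then 0
             else shuffle_sign R I [set i]%SET * u (i |: I)%SET].

(* Schouten bracket in coordinates.  Sign convention: [X, f] = X(f), [X, Y]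
   is the Lie bracket, and for A, B of degrees p, q
     [A, B /\ C] = [A, B] /\ C + (-1)^((p - 1) q) B /\ [A, C],
   so that [Y1 /\ Y2, f] = Y2(f) Y1 - Y1(f) Y2.  Hence, for the tensor
   L = b Y1/\Y2 + 2b Y2/\Y3 + a Y3/\Y1, [L, f Y] = (sum_i X_i(f) Y_i) /\ Y
   with X1 = b Y2 - a Y3, X2 = 2b Y3 - b Y1, X3 = a Y1 - 2b Y2. *)
Definition schouten (R : realType) (u v : mvf R) : mvf R :=
  \sum_(i < 3) (wedge (rderiv i u) (coef_deriv i v)
                - wedge (coef_deriv i u) (lderiv i v)).

Definition one (R : realType) : mvf R := basis R finset.set0.
Definition pd (R : realType) (i : 'I_3) : mvf R := basis R [set i]%SET.

Definition Y1 (R : realType) : mvf R :=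
  coord R i1 *: pd R i1 + coord R i2 *: pd R i2.
Definition Y2 (R : realType) : mvf R :=
  coord R i1 *: pd R i2 - coord R i2 *: pd R i1.
Definition Y3 (R : realType) : mvf R := coord R i3 *: pd R i3.

Definition Dfun (R : realType) : ratfun R :=
  (coord R i1 ^+ 2 + coord R i2 ^+ 2) * coord R i3.

(* Only used for k <= r, where [r - k] is not truncated. *)
Definition Ppoly (R : realType) (k r : nat) : set (ratfun R) :=
  [set p | exists c : 'I_k.+1 -> R,
     p = \sum_(l < k.+1) rconst (c l) * coord R i1 ^+ l
           * coord R i2 ^+ (k - l) * coord R i3 ^+ (r - k)].

Definition Qfrac (R : realType) (k r : nat) : set (ratfun R) :=
  [set p / Dfun R | p in @Ppoly R k r].

Definition when (V : zmodType) (b : bool) (A : set V) : set V :=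
  if b then A else [set 0].

Definition addset (V : zmodType) (A B : set V) : set V :=
  [set u + v | u in A & v in B].

Definition along (R : realType) (A : set (ratfun R)) (e : mvf R) :
  set (mvf R) := [set f *: e | f in A].

Definition Pcochain (R : realType) (d k r : nat) : set (mvf R) :=
  let Q := @Qfrac R k r in
  match d with
  | 0%N => when [&& 2 <= k, 3 <= r & k <= r.-1]%N (along Q (one R))
  | 1%N => when [&& 1 <= k, 2 <= r & k <= r]%N
      (addset (addset (when (k != r) (along Q (Y1 R)))
                      (when (k != r) (along Q (Y2 R))))
              (when (k != 1%N) (along Q (Y3 R))))
  | 2%N => when [&& 0 <= k, 1 <= r & k <= r]%N
      (addset (addset (when (k != 0%N) (along Q (wedge (Y2 R) (Y3 R))))
                      (when (k != 0%N) (along Q (wedge (Y3 R) (Y1 R)))))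
              (when (k != r) (along Q (wedge (Y1 R) (Y2 R)))))
  | 3%N => when (k <= r)%N (along Q (wedge (wedge (Y1 R) (Y2 R)) (Y3 R)))
  | _ => [set 0]
  end.

Definition Rcochain (R : realType) (d k r : nat) : set (mvf R) :=
  let P := @Ppoly R in
  let e i j := wedge (pd R i) (pd R j) in
  match d with
  | 0%N => when [&& 2 <= k, 3 <= r & k <= r.-1]%N
      (along (P (k - 2) (r - 3))%N (one R))
  | 1%N => when [&& 1 <= k, 2 <= r & k <= r]%N
      (addset (addset (when (k != r) (along (P (k - 1) (r - 2))%N (pd R i1)))
                      (when (k != r) (along (P (k - 1) (r - 2))%N (pd R i2))))
              (when (k != 1%N) (along (P (k - 2) (r - 2))%N (pd R i3))))
  | 2%N => when [&& 0 <= k, 1 <= r & k <= r]%N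
      (addset (addset (when (k != 0%N) (along (P (k - 1) (r - 1))%N (e i2 i3)))
                      (when (k != 0%N) (along (P (k - 1) (r - 1))%N (e i3 i1))))
              (when (k != r) (along (P k (r - 1))%N (e i1 i2))))
  | 3%N => when (k <= r)%N (along (P k r) (wedge (e i1 i2) (pd R i3)))
  | _ => [set 0]
  end.

Record subquotient (V : Type) := Subquotient {
  cycles : set V;
  boundaries : set V }.

Definition cohomology (V : zmodType) (delta : V -> V) (C : nat -> set V)
    (d : nat) : subquotient V :=
  Subquotient [set z | C d z /\ delta z = 0]
              (if d is d'.+1 then [set delta w | w in C d'] else [set 0]).

(* S is a space of cochains representing H: it consists of cocycles, and each
   class has exactly one representative in S. *)
Definition represents (V : zmodType) (S : set V) (H : subquotient V) : Prop :=
  S `<=` cycles H /\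
  forall z, cycles H z -> exists! s, S s /\ boundaries H (z - s).

(* The inclusion of cocycles induces an isomorphism from H to H'. *)
Definition coincide (V : zmodType) (H H' : subquotient V) : Prop :=
  [/\ cycles H `<=` cycles H',
      boundaries H `<=` boundaries H',
      forall z, cycles H z -> boundaries H' z -> boundaries H z
    & forall z', cycles H' z' -> exists2 z, cycles H z & boundaries H' (z' - z)].

(* A formal, possibly infinite, sum of cochains is the family of its
   components of bidegree (k, r). *)
Notation fcochain R := (nat -> nat -> mvf R).

Definition formal_sum (R : realType) (I : set (nat * nat))
    (A : nat -> nat -> set (mvf R)) : set (fcochain R) :=
  [set u | forall k r, (I (k, r) -> A k r (u k r)) /\
                       (~ I (k, r) -> u k r = 0)].

Definition in_bidegree (R : realType) (k r : nat) (v : mvf R) : fcochain R :=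
  fun k' r' => if (k' == k) && (r' == r) then v else 0.

Definition total_cohomology (R : realType) (L : mvf R)
    (C : nat -> nat -> nat -> set (mvf R)) (d : nat) :
    subquotient (fcochain R) :=
  cohomology (fun (u : fcochain R) k r => schouten L (u k r))
             (fun d => formal_sum setT (C d)) d.

Definition graded_cohomology (R : realType) (L : mvf R)
    (C : nat -> nat -> nat -> set (mvf R)) (d k r : nat) :
    subquotient (mvf R) :=
  cohomology (schouten L) (fun d => C d k r) d.

(* The formal direct sum of the (k, r)-cohomology spaces for (k, r) in I. *)
Definition sum_cohomology (R : realType) (L : mvf R)
    (C : nat -> nat -> nat -> set (mvf R)) (d : nat) (I : set (nat * nat)) :
    subquotient (fcochain R) :=
  Subquotient
    (formal_sum I (fun k r => cycles (graded_cohomology L C d k r)))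
    (formal_sum I (fun k r => boundaries (graded_cohomology L C d k r))).

(* The constants; since 1 = D / D, they have bidegree (2, 3). *)
Definition constants (R : realType) : set (fcochain R) :=
  [set u | exists c : R, u = in_bidegree 2%N 3%N (rconst c *: one R)].

(* The formal sum of the c_m D^m; since D^m = D^(m+1) / D, its m-th term has
   bidegree (2(m+1), 3(m+1)), and only m < k can contribute to degree k. *)
Definition Dseries (R : realType) (c : nat -> R) : fcochain R :=
  fun k r => \sum_(m < k)
    in_bidegree (2 * m.+1)%N (3 * m.+1)%N
      ((rconst (c m) * Dfun R ^+ m) *: one R) k r.

(* Main.v *)
Require Import Defs.
From HB Require Import structures.
From mathcomp Require Import all_boot all_order all_algebra.
From mathcomp Require Import mpoly.
From mathcomp Require Import boolp classical_sets functions reals.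
From mathcomp Require Import ring lra zify.

(* A potential 0-cochain of bidegree (k, r) is f = x2^k x3^(r-k) P(t) / D with
   t = x1 / x2 and P a real polynomial in one variable.  Since Y1, Y2, Y3 are
   independent over the field of rational functions, f is a cocycle iff
   Y1 f = 2 Y3 f and b Y2 f = a Y3 f.  The fields Y1 and Y3 act on f by the
   scalars k - 2 and r - k - 1, so the first equation reads 3k = 2r.  As
   Y2 t = - (1 + t^2), the second one becomes the differential equation
   (1 + X^2) P' = (k X - l) P with l = a (r - k - 1) / b, which forces l = 0
   and P = c (1 + X^2)^(k/2): then f is a multiple of a power of D.  There are
   no coboundaries in degree 0, so each of the cohomology spaces is its space
   of cocycles. *)

Set Implicit Arguments.
Unset Strict Implicit.
Unset Printing Implicit Defensive.

Import GRing.Theory Num.Theory.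
Local Open Scope classical_set_scope.
Local Open Scope ring_scope.

(* all_algebra and classical_sets shadow these names *)
Local Notation coord := Defs.coord.
Local Notation one := Defs.one.

(** * The polynomial equation (1 + X^2) p' = (k X - l) p *)

Lemma size_1_addX2 (F : nzRingType) : size (1 + 'X^2 : {poly F}) = 3%N.
Proof. by rewrite addrC -[1]/(1%:P) size_XnaddC. Qed.

(* Multiplying by [- k X - l] makes the coefficient of [p] constant modulo
   [1 + X^2], so [1 + X^2] divides [p]; the quotient satisfies the equation
   with [k - 2] in place of [k]. *)
Lemma rotation_eigenpoly (F : realFieldType) (k l : F) (p : {poly F}) :
  p != 0 -> (1 + 'X^2) * p^`() = (k *: 'X - l%:P) * p ->
  exists m c, [/\ k = (2 * m)%:R, l = 0 & p = c *: (1 + 'X^2) ^+ m].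
Proof.
have q_neq0 : (1 + 'X^2 : {poly F}) != 0.
  by rewrite -size_poly_eq0 size_1_addX2.
(* The induction generalises k, which is a scalar rather than a natural number so that k - 2 always
   makes sense. *)
have [n] := ubnP (size p); elim: n => // n IHn in k p * => size_p p_neq0 pE.
have [kl0|kl_neq0] := eqVneq (l ^+ 2 + k ^+ 2) 0.
  (* In an ordered field the sum of squares vanishes only for k = l = 0; then p' = 0, and p is
     constant by characteristic zero. *)
  have [l0 k0] : l = 0 /\ k = 0 by split; nra.
  exists 0%N, p`_0; split=> //.
  move/eqP: pE; rewrite l0 k0 scale0r subr0 mul0r mulf_eq0 (negPf q_neq0) /=.
  move=> /eqP p'0; rewrite expr0 alg_polyC; apply/polyP => i; rewrite coefC.
  case: i => // i /=; have /eqP := coef_deriv p i; rewrite p'0 coef0 eq_sym.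
  by rewrite mulrn_eq0 /= => /eqP.
(* As k^2 X^2 - l^2 = k^2 (1 + X^2) - (l^2 + k^2), multiplying the equation by k X + l gives (l^2 +
   k^2) p = (1 + X^2) (k^2 p - (k X + l) p'). *)
pose s := (l ^+ 2 + k ^+ 2)^-1 *: (k ^+ 2 *: p - (k *: 'X + l%:P) * p^`()).
have ps : p = (1 + 'X^2) * s.
  rewrite /s -scalerAr mulrBr [_ * (_ * p^`())]mulrCA pE.
  apply: (scalerI kl_neq0); rewrite scalerA mulfV // scale1r.
  rewrite -!mul_polyC !rmorphD !rmorphXn /=; ring.
have s_neq0 : s != 0 by apply: contra_neq p_neq0 => s0; rewrite ps s0 mulr0.
have s_lt : (size s < n)%N.
  move: size_p; rewrite ps size_mul // size_1_addX2.
  by case: (size s) => //= ? ; lia.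
have sE : (1 + 'X^2) * s^`() = ((k - 2) *: 'X - l%:P) * s.
  have := pE; rewrite {1 2}ps derivM derivD derivXn -[1]/(1%:P) derivC add0r /= expr1.
  move=> psE; apply: (mulfI q_neq0).
  transitivity ((1 + 'X^2) * ('X *+ 2 * s + (1 + 'X^2) * s^`()) - (1 + 'X^2) * ('X *+ 2 * s)).
    by ring.
  by rewrite psE -!mul_polyC rmorphB /= polyC_natr; ring.
have [m [c [kE lE {}sE]]] := IHn _ _ s_lt s_neq0 sE; exists m.+1, c; split=> //.
  by rewrite mulnS natrD -kE addrC subrK.
by rewrite ps sE -scalerAr [in RHS](exprS _ m).
Qed.

(** * Derivations and logarithmic derivatives *)

Section Derivations.

Variables (F K : fieldType) (phi : {rmorphism F -> K}).

Definition derivation (d : K -> K) : Prop :=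
  [/\ {morph d : x y / x + y}, forall x y, d (x * y) = d x * y + x * d y
    & forall c, d (phi c) = 0].

Lemma derivation_comb (d1 d2 : K -> K) (u v : K) :
  derivation d1 -> derivation d2 -> derivation (fun x => u * d1 x + v * d2 x).
Proof.
move=> [D1 M1 C1] [D2 M2 C2]; split=> [x y|x y|c]; rewrite ?(D1, D2) ?(M1, M2).
- by ring.
- by ring.
- by rewrite C1 C2 !mulr0 addr0.
Qed.

Variables (d : K -> K) (d_der : derivation d).

(** The factors are logarithmic derivatives: arbitrary elements of K, not only constants. They add
    up over products, hence the rules for powers and inverses that follow. *)
Lemma deriv_eigenM u v x y : d x = u * x -> d y = v * y ->
  d (x * y) = (u + v) * (x * y).
Proof. by case: d_der => _ dM _ dx dy; rewrite dM dx dy; ring. Qed.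

Lemma deriv_eigenX u x n : d x = u * x -> d (x ^+ n) = (n%:R * u) * x ^+ n.
Proof.
move=> dx; elim: n => [|n IHn]; last by rewrite exprS (deriv_eigenM dx IHn) mulrS; ring.
by case: d_der => _ _ dC; rewrite expr0 -(rmorph1 phi) dC !mul0r.
Qed.

Lemma deriv_eigenV v y : d y = v * y -> d y^-1 = - v * y^-1.
Proof.
(* Since 0^-1 = 0, for y = 0 the claim reduces to its hypothesis. *)
have [->|y_neq0 dy] := eqVneq y 0.
  by rewrite invr0 !mulr0.
apply: (mulfI y_neq0); case: d_der => _ dM dC.
have := dM y y^-1; rewrite divff // -{1}(rmorph1 phi) dC dy mulfK // => /esym/eqP.
by rewrite addrC addr_eq0 => /eqP ->; rewrite mulrCA divff // mulr1.
Qed.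

Lemma deriv_horner (p : {poly F}) x :
  d (map_poly phi p).[x] = (map_poly phi p^`()).[x] * d x.
Proof.
case: d_der => dD dM dC; elim/poly_ind: p => [|p c IHp].
  by rewrite deriv0 rmorph0 horner0 mul0r -[in LHS](rmorph0 phi) dC.
rewrite derivD derivM derivX derivC !rmorphD !rmorphM /= map_polyX map_polyC /=.
rewrite rmorph0 !hornerE dD dM IHp dC.
by rewrite rmorph1 hornerC; ring.
Qed.

End Derivations.

Lemma add_sqr_horner (F K : fieldType) (phi : {rmorphism F -> K}) (x y : K) :
  y != 0 -> x ^+ 2 + y ^+ 2 = y ^+ 2 * (map_poly phi (1 + 'X^2)).[x / y].
Proof.
move=> y_neq0; rewrite rmorphD rmorph1 /= map_polyXn hornerD hornerXn hornerC.
by field.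
Qed.

(** * Potential 0-cocycles over a field with three derivations *)

Section PotentialCocycles.

Variables (F : realFieldType) (K : fieldType) (phi : {rmorphism F -> K}).
Variables (x1 x2 x3 : K) (d1 d2 d3 : K -> K).
Hypotheses (d1P : derivation phi d1) (d2P : derivation phi d2)
  (d3P : derivation phi d3).
Hypotheses (d1E : [/\ d1 x1 = 1, d1 x2 = 0 & d1 x3 = 0])
  (d2E : [/\ d2 x1 = 0, d2 x2 = 1 & d2 x3 = 0])
  (d3E : [/\ d3 x1 = 0, d3 x2 = 0 & d3 x3 = 1]).
Hypothesis transc : forall p : {poly F}, (map_poly phi p).[x1 / x2] = 0 -> p = 0.
Hypotheses (x2_neq0 : x2 != 0) (x3_neq0 : x3 != 0).

Let E := x1 ^+ 2 + x2 ^+ 2.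
Let D := E * x3.
Let t := x1 / x2.

Let EE : E = x2 ^+ 2 * (map_poly phi (1 + 'X^2)).[t].
Proof. exact: add_sqr_horner. Qed.

Let E_neq0 : E != 0.
Proof.
rewrite EE mulf_neq0 ?expf_neq0 //; apply/eqP => /transc /eqP.
by rewrite -size_poly_eq0 size_1_addX2.
Qed.

(** Here n stands for r - k, and the two equations are components of the cocycle condition in the
    coordinate frame. With no lower bound on k, the solution f = c / D, of index m = 0, still
    occurs. *)
Lemma potential_cocycle (a b : F) (k n : nat) (p : {poly F})
    (f := x2 ^+ k * x3 ^+ n * (map_poly phi p).[t] / D) :
  b != 0 -> p != 0 ->
  phi b * E * d1 f = x3 * (2 * phi b * x1 - phi a * x2) * d3 f ->
  phi b * E * d2 f = x3 * (2 * phi b * x2 + phi a * x1) * d3 f ->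
  exists m c, [/\ k = (2 * m)%N, n = m, f = phi c * D ^+ m / D
                & a = 0 \/ m = 1%N].
Proof.
move=> b_neq0 p_neq0 E1 E2.
have phi_inj := fmorph_inj phi.
pose Y1 x := x1 * d1 x + x2 * d2 x.
pose Y2 x := x1 * d2 x + - x2 * d1 x.
(* The zero summand gives [Y3] the shape required by [derivation_comb]. *)
pose Y3 x := x3 * d3 x + 0 * d3 x.
have Y1P : derivation phi Y1 by exact: derivation_comb.
have Y2P : derivation phi Y2 by exact: derivation_comb.
have Y3P : derivation phi Y3 by exact: derivation_comb.
have pb_neq0 : phi b != 0 by rewrite fmorph_eq0.
(* The hypotheses, weighted by x1 and x2, add up to b E (Y1 f) = 2 b E (Y3 f); weighted by - x2 and
   x1, they give E b (Y2 f) = E a (Y3 f) below. *)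
have Y13 : Y1 f = 2 * Y3 f.
  apply: (mulfI (mulf_neq0 pb_neq0 E_neq0)); rewrite /Y1 /Y3.
  transitivity (x1 * (phi b * E * d1 f) + x2 * (phi b * E * d2 f)); first by ring.
  by rewrite E1 E2 /E; ring.
have Y23 : phi b * Y2 f = phi a * Y3 f.
  apply: (mulfI E_neq0); rewrite /Y2 /Y3.
  transitivity (x1 * (phi b * E * d2 f) - x2 * (phi b * E * d1 f)); first by ring.
  by rewrite E1 E2 /E; ring.
case: d1E => d11 d12 d13; case: d2E => d21 d22 d23; case: d3E => d31 d32 d33.
(* In the splitting f = g h, each Yi multiplies g by a logarithmic derivative, while h depends on t
   alone, which Y1 and Y3 kill. *)
set h := (map_poly phi p).[t].
pose g := x2 ^+ k * x3 ^+ n / D.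
have fE : f = g * h by rewrite /f /g mulrAC.
have g_neq0 : g != 0 by rewrite !mulf_neq0 ?expf_neq0 ?invr_neq0 // mulf_neq0.
have h_neq0 : h != 0 by apply: contra_neq p_neq0 => /transc.
(* The letters u, v and w are the logarithmic derivatives of x2, x3 and E; the denominator D = E x3
   contributes w + v. *)
have gY d u v w : derivation phi d -> d x2 = u * x2 -> d x3 = v * x3 ->
    d E = w * E -> d g = (k%:R * u + n%:R * v - (w + v)) * g.
  move=> dP dx2 dx3 dE.
  apply: (deriv_eigenM dP); last first.
    by apply: (deriv_eigenV dP); apply: (deriv_eigenM dP).
  by apply: (deriv_eigenM dP); apply: (deriv_eigenX dP).
have dE d : derivation phi d -> d E = 2 * x1 * d x1 + 2 * x2 * d x2.
  by move=> [dD dM _]; rewrite /E dD !expr2 !dM; ring.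
have dt d u : derivation phi d -> d x2 = u * x2 -> d t = d x1 / x2 - u * t.
  move=> dP dx2; have [_ dM _] := dP.
  by rewrite /t dM (deriv_eigenV dP dx2); ring.
have Y1g : Y1 g = (k%:R * 1 + n%:R * 0 - (2 + 0)) * g.
  apply: gY; rewrite // ?(dE Y1) // /E /Y1 ?d11 ?d12 ?d13 ?d21 ?d22 ?d23; ring.
have Y3g : Y3 g = (k%:R * 0 + n%:R * 1 - (0 + 1)) * g.
  apply: gY; rewrite // ?(dE Y3) // /E /Y3 ?d31 ?d32 ?d33; ring.
(* The rotation Y2 kills E and x3 and sends x2 to x1 = t x2, so its factor on g is k t. *)
have Y2g : Y2 g = (k%:R * t + n%:R * 0 - (0 + 0)) * g.
  apply: gY; rewrite // ?(dE Y2) // /E /Y2 ?d11 ?d12 ?d13 ?d21 ?d22 ?d23 /t; try ring.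
  by field.
have Yh d : derivation phi d -> d h = (map_poly phi p^`()).[t] * d t.
  by move=> dP; rewrite /h (deriv_horner dP).
have Y1t : Y1 t = 0.
  by rewrite (dt _ 1) // /Y1 ?d11 ?d12 ?d21 ?d22 /t; field.
have Y3t : Y3 t = 0.
  by rewrite (dt _ 0) // /Y3 ?d31 ?d32 /t; field.
have Y2t : Y2 t = - (map_poly phi (1 + 'X^2)).[t].
  rewrite (dt _ t) // /Y2 ?d11 ?d12 ?d21 ?d22.
    rewrite rmorphD rmorph1 /= map_polyXn hornerD hornerXn hornerC /t.
    by field.
  by rewrite /t; field.
have [[_ M1 _] [_ M2 _] [_ M3 _]] := And3 Y1P Y2P Y3P.
have Y3f : Y3 f = (n%:R - 1) * f.
  by rewrite fE M3 Y3g (Yh Y3) // Y3t; ring.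
have Y1f : Y1 f = (k%:R - 2) * f.
  by rewrite fE M1 Y1g (Yh Y1) // Y1t; ring.
have f_neq0 : f != 0 by rewrite fE mulf_neq0.
(* The eigenvalues of Y1 and Y3 on f give k - 2 = 2 (n - 1) in K; this descends to natural numbers
   because phi is injective and F has characteristic zero. *)
have kn : (k = 2 * n)%N.
  apply/eqP; rewrite -(eqr_nat F); apply/eqP; apply: phi_inj.
  rewrite natrM rmorphM /= !rmorph_nat.
  have kn : k%:R - 2 = 2 * (n%:R - 1) :> K.
    by apply: (mulIf f_neq0); rewrite -Y1f Y13 Y3f mulrA.
  by rewrite -[LHS](subrK 2) kn; ring.
have [l l_def] : exists l, l = a * (n%:R - 1) / b by exists (a * (n%:R - 1) / b).
have ode : (1 + 'X^2) * p^`() = (k%:R *: 'X - l%:P) * p.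
  (* By transcendence of t the polynomial identity may be tested at t; there, multiplied by b and g,
     it is b Y2 f = a Y3 f. *)
  apply/eqP; rewrite -subr_eq0; apply/eqP; apply: transc.
  apply/eqP; rewrite rmorphB !rmorphM rmorphB /= map_polyZ map_polyX map_polyC /=.
  rewrite hornerD hornerN [(_ * map_poly phi p).[_]]hornerM hornerM -/h subr_eq0.
  rewrite !hornerE -/t /= rmorph_nat l_def fmorph_div rmorphM rmorphB rmorph_nat rmorph1 /=.
  apply/eqP; apply: (mulfI pb_neq0); apply: (mulfI g_neq0).
  move: Y23; rewrite Y3f fE M2 Y2g (Yh _ Y2P) Y2t.
  set e := (map_poly _ _).[t]; set q := (map_poly _ _).[t].
  move=> Y23; transitivity (phi b * (k%:R * t) * g * h - phi a * ((n%:R - 1) * (g * h))).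
    by rewrite -Y23; ring.
  by rewrite /t; field; rewrite pb_neq0.
have [m [c [kE lE pE]]] := @rotation_eigenpoly F _ _ p p_neq0 ode.
have {}kE : k = (2 * m)%N by apply/eqP; rewrite -(eqr_nat F) kE.
have nm : n = m by lia.
exists m, c; split=> //.
  rewrite /f pE kE nm linearZ /= hornerZ rmorphXn /= horner_exp.
  by rewrite exprMn EE exprMn exprM; ring.
move/eqP: lE; rewrite l_def !mulf_eq0 invr_eq0 (negPf b_neq0) orbF nm.
move=> /orP [/eqP ->|]; first by left.
by rewrite subr_eq0 pnatr_eq1 => /eqP ->; right.
Qed.

End PotentialCocycles.

(** * Partial derivatives of rational functions *)

Lemma quotient_ruleD (K : fieldType) (n d m e n' d' m' e' : K) :
  d != 0 -> e != 0 ->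
  ((n' * e + n * e' + (m' * d + m * d')) * (d * e)
     - (n * e + m * d) * (d' * e + d * e')) / (d * e) ^+ 2 =
  (n' * d - n * d') / d ^+ 2 + (m' * e - m * e') / e ^+ 2.
Proof. by move=> ? ?; field; apply/andP. Qed.

(** Here and in [quotient_ruleD] the primed letters stand for derivatives, so these are the sum and
    product rules for the quotient rule, left to [field] on plain variables. *)
Lemma quotient_ruleM (K : fieldType) (n d m e n' d' m' e' : K) :
  d != 0 -> e != 0 ->
  ((n' * m + n * m') * (d * e) - (n * m) * (d' * e + d * e')) / (d * e) ^+ 2 =
  (n' * d - n * d') / d ^+ 2 * (m / e) + n / d * ((m' * e - m * e') / e ^+ 2).
Proof. by move=> ? ?; field; apply/andP. Qed.

Section RationalFunctions.

Variable R : realType.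
Implicit Types (i : 'I_3) (f g : ratfun R) (n d : {mpoly R[3]}).

Lemma rconst_is_zmod_morphism : zmod_morphism (@rconst R).
Proof. by move=> x y; rewrite /rconst !rmorphB. Qed.

Lemma rconst_is_monoid_morphism : monoid_morphism (@rconst R).
Proof. by split=> [|x y]; rewrite /rconst ?rmorph1 ?rmorphM. Qed.

HB.instance Definition _ := GRing.isZmodMorphism.Build R (ratfun R) (@rconst R)
  rconst_is_zmod_morphism.
HB.instance Definition _ := GRing.isMonoidMorphism.Build R (ratfun R) (@rconst R)
  rconst_is_monoid_morphism.

Lemma ratfun_numden f :
  f = tofrac (frac (repr f)).1 / tofrac (frac (repr f)).2.
Proof.
have d_neq0 : tofrac (frac (repr f)).2 != 0 :> ratfun R.
  by rewrite tofrac_eq0 denom_ratioP.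
apply: (mulIf d_neq0); rewrite divfK //.
move: d_neq0 => _; move: (repr f) (reprK f) => x <-.
unlock FracField.tofrac; rewrite -[LHS]FracField.pi_mul.
apply/eqP; rewrite FracField.equivf_def /FracField.mulf.
by rewrite !numden_Ratio ?mulf_neq0 ?oner_neq0 ?denom_ratioP // !mulr1 mulrC.
Qed.

(** Independence of the representative: if n / d = N / M, then differentiating n M = N d shows that
    the quotient rule takes the same value on both fractions. *)
Lemma pderiv_div i n d : d != 0 ->
  pderiv i (tofrac n / tofrac d : ratfun R) =
  tofrac (n^`M(i) * d - n * d^`M(i)) / tofrac d ^+ 2.
Proof.
move=> d_neq0; set f : ratfun R := tofrac n / tofrac d; rewrite /pderiv.
have := ratfun_numden f; have := denom_ratioP (repr f).
set N := (frac _).1; set M := (frac _).2 => M_neq0 /eqP.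
rewrite -/N -/M {1}/f eqr_div ?tofrac_eq0 // -!tofracM tofrac_eq => /eqP nM.
have := congr1 (mderiv i) nM; rewrite !mderivM => nM'.
apply/eqP; rewrite eqr_div ?expf_neq0 ?tofrac_eq0 //.
rewrite -!tofracXn -!tofracM tofrac_eq; apply/eqP.
rewrite mulrBl mulrBl.
transitivity (N^`M(i) * d * (M * d) - (N * d) * M^`M(i) * d); first by ring.
rewrite -nM; transitivity ((N^`M(i) * d - n * M^`M(i)) * (M * d)); first by ring.
have -> : N^`M(i) * d - n * M^`M(i) = n^`M(i) * M - N * d^`M(i).
  by apply/eqP; rewrite subr_eq addrAC eq_sym subr_eq nM' eq_sym.
transitivity (n^`M(i) * d * M ^+ 2 - (N * d) * M * d^`M(i)); first by ring.
by rewrite -nM; ring.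
Qed.

Lemma pderiv_tofrac i n : pderiv i (tofrac n : ratfun R) = tofrac n^`M(i).
Proof.
rewrite -[X in pderiv i X]divr1 -tofrac1 pderiv_div ?oner_neq0 //.
by rewrite -mpolyC1 mderivC mulr0 subr0 mpolyC1 mulr1 tofrac1 expr1n divr1.
Qed.

Lemma pderivP i : derivation (@rconst R) (pderiv i).
Proof.
have dd f : tofrac (frac (repr f)).2 != 0 :> ratfun R.
  by rewrite tofrac_eq0 denom_ratioP.
split=> [f g|f g|c].
- rewrite {1}(ratfun_numden f) {1}(ratfun_numden g) addf_div // -!tofracM -tofracD.
  rewrite pderiv_div ?mulf_neq0 ?denom_ratioP // /pderiv.
  rewrite mderivD !mderivM !(tofracB, tofracM, tofracD).
  exact: quotient_ruleD.
- have -> : pderiv i f * g + f * pderiv i g =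
      pderiv i f * (tofrac (frac (repr g)).1 / tofrac (frac (repr g)).2)
      + tofrac (frac (repr f)).1 / tofrac (frac (repr f)).2 * pderiv i g.
    by rewrite -!ratfun_numden.
  rewrite {1}(ratfun_numden f) {1}(ratfun_numden g) mulf_div // -!tofracM.
  rewrite pderiv_div ?mulf_neq0 ?denom_ratioP // /pderiv.
  rewrite !mderivM !(tofracB, tofracM, tofracD).
  exact: quotient_ruleM.
- by rewrite /rconst pderiv_tofrac mderivC tofrac0.
Qed.

Lemma pderiv_coord i j : pderiv i (coord R j) = (i == j)%:R.
Proof.
rewrite /coord pderiv_tofrac mderivX mnm1E; case: eqVneq => [->|_].
  rewrite scale1r (_ : (U_(i) - U_(i))%MM = 0%MM) ?mpolyX0 ?tofrac1 //.
  by apply/mnmP => k; rewrite mnmBE subnn mnm0E.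
by rewrite scale0r tofrac0.
Qed.

Lemma coord_neq0 i : coord R i != 0.
Proof. by rewrite tofrac_eq0 -msize_poly_eq0 msizeX. Qed.

End RationalFunctions.

(** * The Schouten bracket of the Poisson tensor with a function *)

Section FunctionCocycles.

Variable R : realType.
Implicit Types (u v : mvf R) (f : ratfun R) (I : {set 'I_3}) (i j : 'I_3).

Local Notation x1 := (coord R i1).
Local Notation x2 := (coord R i2).
Local Notation x3 := (coord R i3).

Lemma wedgeE u v I : wedge u v I = \sum_(J : {set 'I_3} | J \subset I)
  shuffle_sign R J (I :\: J)%SET * u J * v (I :\: J)%SET.
Proof. exact: ffunE. Qed.

Lemma coef_derivE i u I : Defs.coef_deriv i u I = pderiv i (u I).
Proof. exact: ffunE. Qed.

Lemma lderivE i u I : lderiv i u I =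
  if i \in I then 0 else shuffle_sign R [set i]%SET I * u (i |: I)%SET.
Proof. exact: ffunE. Qed.

Lemma rderivE i u I : rderiv i u I =
  if i \in I then 0 else shuffle_sign R I [set i]%SET * u (i |: I)%SET.
Proof. exact: ffunE. Qed.

(* Comparing two different multivector fields up to conversion is very slow. *)
Local Opaque pderiv wedge Defs.coef_deriv lderiv rderiv.

Lemma fun_fieldE f I : (f *: one R) I = (if I == finset.set0 then f else 0) :> ratfun R.
Proof. by rewrite !ffunE; case: (I == finset.set0); [exact: mulr1 | exact: mulr0]. Qed.

Lemma wedge_fun u f I : wedge u (f *: one R) I = u I * f :> ratfun R.
Proof.
rewrite wedgeE (bigD1 I) //= big1 ?addr0 => [|J /andP [JI J_neq]].
  rewrite finset.setDv fun_fieldE eqxx /shuffle_sign big1 ?expr0 ?mul1r //.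
  by move=> i _; rewrite big_pred0 // => j; rewrite finset.inE.
have /negPf IJ : ~~ (I \subset J).
  by apply: contra J_neq => IJ; rewrite finset.eqEsubset JI.
by rewrite fun_fieldE finset.setD_eq0 IJ !mulr0.
Qed.

Lemma mvf_addE u v I : (u + v) I = u I + v I.
Proof. exact: ffunE. Qed.

Lemma mvf_scaleE f u I : (f *: u) I = f * u I :> ratfun R.
Proof. exact: ffunE. Qed.

Lemma mvf_subE u v I : (u - v) I = u I - v I.
Proof. by rewrite ffunE [X in _ + X]ffunE. Qed.

Lemma coef_deriv_fun i f : Defs.coef_deriv i (f *: one R) = pderiv i f *: one R.
Proof.
have [_ _ dC] := pderivP R i; apply/ffunP => J; rewrite coef_derivE.
apply: etrans (congr1 (pderiv i) (fun_fieldE f J)) _.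
apply: etrans _ (esym (fun_fieldE (pderiv i f) J)).
by case: (J == finset.set0); rewrite // -(rmorph0 (@rconst R)) dC rmorph0.
Qed.

(** Zero is written as [0 *: one R] so that [wedge_fun] applies to it. *)
Lemma lderiv_fun i f : lderiv i (f *: one R) = 0 *: one R.
Proof.
apply/ffunP => J; rewrite lderivE; apply: etrans _ (esym (fun_fieldE 0 J)).
rewrite if_same; case: ifP => // _; rewrite fun_fieldE.
rewrite (_ : (_ |: _)%SET == _ = false) ?mulr0 //.
by apply/eqP => /setP /(_ i); rewrite !finset.inE eqxx.
Qed.

(** A function contains no odd variable, so its left derivatives vanish and only the first half of
    the bracket survives. *)
Lemma schouten_fun u f I :
  schouten u (f *: one R) I = \sum_i rderiv i u I * pderiv i f :> ratfun R.
Proof.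
rewrite sum_ffunE; apply: eq_bigr => i _.
rewrite coef_deriv_fun lderiv_fun mvf_subE.
apply: etrans (congr2 (fun x y : ratfun R => x - y)
  (wedge_fun (rderiv i u) (pderiv i f) I) (wedge_fun (Defs.coef_deriv i u) 0 I)) _.
by rewrite mulr0 subr0.
Qed.

Lemma shuffle_sign1 i j : shuffle_sign R [set i]%SET [set j]%SET = (-1) ^+ (j < i)%N.
Proof. by rewrite /shuffle_sign !big_set1. Qed.

Definition homogeneous n u := forall I, #|I| != n -> u I = 0.

Lemma wedge_homogeneous u v :
  homogeneous 1 u -> homogeneous 1 v -> homogeneous 2 (wedge u v).
Proof.
move=> u1 v1 I I2; rewrite wedgeE big1 // => J JI.
have [J1|/u1 ->] := eqVneq #|J| 1%N; last by rewrite mulr0 mul0r.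
rewrite v1 ?mulr0 //; apply: contra I2 => /eqP IJ1.
by rewrite -(cardsID J I) IJ1 (finset.setIidPr JI) J1.
Qed.

(** As u lives in degree 1, only the two splittings of {i, j} into singletons contribute, the second
    with sign -1. *)
Lemma wedge_pair u v i j : homogeneous 1 u -> (i < j)%N ->
  wedge u v [set i; j]%SET =
  u [set i]%SET * v [set j]%SET - u [set j]%SET * v [set i]%SET.
Proof.
move=> u1 ij; have ji : (j < i)%N = false by rewrite ltnNge ltnW.
have i_neq : j != i by apply: contraTneq ij => ->; rewrite ltnn.
have Di : ([set i; j] :\: [set i] = [set j])%SET.
  apply/setP => k; rewrite !finset.inE; case: (eqVneq k i) => //= ->.
  by rewrite eq_sym (negPf i_neq).
have Dj : ([set i; j] :\: [set j] = [set i])%SET.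
  apply/setP => k; rewrite !finset.inE; case: (eqVneq k j) => //= [->|].
    by rewrite (negPf i_neq).
  by rewrite orbF.
rewrite wedgeE (bigD1 [set i]%SET) ?finset.sub1set ?finset.set21 //=.
rewrite (bigD1 [set j]%SET) /=; last by rewrite finset.sub1set finset.set22 (inj_eq set1_inj).
rewrite big1 => [|J /andP [/andP [JI Ji] Jj]].
  by rewrite Di Dj !shuffle_sign1 ij ji; ring.
rewrite u1 ?mulr0 ?mul0r //; apply/negP => /cards1P [k Jk].
move: JI Ji Jj; rewrite Jk finset.sub1set !finset.inE !(inj_eq set1_inj).
by case: eqP => //= _; case: eqP.
Qed.

Lemma pd1 i j : pd R i [set j]%SET = (j == i)%:R.
Proof. by rewrite ffunE (inj_eq set1_inj). Qed.

Lemma pd_homogeneous i : homogeneous 1 (pd R i).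
Proof.
by move=> I; rewrite ffunE; case: (I =P [set i]%SET) => // ->; rewrite cards1.
Qed.

Lemma homogeneous_comb n f g u v : homogeneous n u -> homogeneous n v ->
  homogeneous n (f *: u + g *: v).
Proof. by move=> un vn I In; rewrite !ffunE un ?vn // !scaler0 addr0. Qed.

Lemma Y1_homogeneous : homogeneous 1 (Y1 R).
Proof. by apply: homogeneous_comb; exact: pd_homogeneous. Qed.

Lemma Y2_homogeneous : homogeneous 1 (Y2 R).
Proof. by rewrite /Y2 -scaleNr; apply: homogeneous_comb; exact: pd_homogeneous. Qed.

Lemma Y3_homogeneous : homogeneous 1 (Y3 R).
Proof.
rewrite /Y3 -[X in homogeneous _ X]addr0 -(scale0r (pd R i3)).
by apply: homogeneous_comb; exact: pd_homogeneous.
Qed.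

Lemma Y1E i : Y1 R [set i]%SET = x1 * (i == i1)%:R + x2 * (i == i2)%:R.
Proof.
apply: etrans (mvf_addE _ _ _) _; rewrite -!pd1.
by congr (_ + _); exact: mvf_scaleE.
Qed.

Lemma Y2E i : Y2 R [set i]%SET = x1 * (i == i2)%:R - x2 * (i == i1)%:R.
Proof.
apply: etrans (mvf_subE _ _ _) _; rewrite -!pd1.
by congr (_ - _); exact: mvf_scaleE.
Qed.

Lemma Y3E i : Y3 R [set i]%SET = x3 * (i == i3)%:R.
Proof. by rewrite -pd1; exact: mvf_scaleE. Qed.

Local Opaque Y1 Y2 Y3.

Variables a b : R.

Let L : mvf R := rconst b *: wedge (Y1 R) (Y2 R)
         + rconst (2%:R * b) *: wedge (Y2 R) (Y3 R)
         + rconst a *: wedge (Y3 R) (Y1 R).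

Let LIE I : L I = rconst b * wedge (Y1 R) (Y2 R) I
  + 2 * rconst b * wedge (Y2 R) (Y3 R) I + rconst a * wedge (Y3 R) (Y1 R) I.
Proof.
apply: etrans (mvf_addE _ _ _) _; congr (_ + _); last exact: mvf_scaleE.
apply: etrans (mvf_addE _ _ _) _; congr (_ + _); first exact: mvf_scaleE.
by apply: etrans (mvf_scaleE _ _ _) _; rewrite rmorphM rmorph_nat.
Qed.

Let L_homogeneous : homogeneous 2 L.
Proof.
have sum0 (x y z : ratfun R) : x = 0 -> y = 0 -> z = 0 ->
    rconst b * x + 2 * rconst b * y + rconst a * z = 0.
  by move=> -> -> ->; rewrite !mulr0 !addr0.
move=> I I2; apply: etrans (LIE I) _.
apply: sum0; apply: wedge_homogeneous I2;
  by [exact: Y1_homogeneous | exact: Y2_homogeneous | exact: Y3_homogeneous].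
Qed.

Let LE i j : (i < j)%N -> L [set i; j]%SET =
  let y1 k := x1 * (k == i1)%:R + x2 * (k == i2)%:R in
  let y2 k := x1 * (k == i2)%:R - x2 * (k == i1)%:R in
  let y3 k := x3 * (k == i3)%:R in
  rconst b * (y1 i * y2 j - y1 j * y2 i)
  + 2 * rconst b * (y2 i * y3 j - y2 j * y3 i)
  + rconst a * (y3 i * y1 j - y3 j * y1 i).
Proof.
move=> ij; lazy zeta; apply: etrans (LIE _) _.
congr (_ * _ + _ * _ + _ * _).
- by apply: etrans (wedge_pair _ Y1_homogeneous ij) _;
     congr (_ * _ - _ * _); [exact: Y1E | exact: Y2E | exact: Y1E | exact: Y2E].
- by apply: etrans (wedge_pair _ Y2_homogeneous ij) _;
     congr (_ * _ - _ * _); [exact: Y2E | exact: Y3E | exact: Y2E | exact: Y3E].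
- by apply: etrans (wedge_pair _ Y3_homogeneous ij) _;
     congr (_ * _ - _ * _); [exact: Y3E | exact: Y1E | exact: Y3E | exact: Y1E].
Qed.

Let D := Dfun R.
Let E := x1 ^+ 2 + x2 ^+ 2.
Let L12 : L [set i1; i2]%SET = rconst b * E.
Proof. by rewrite LE //= /E; ring. Qed.
Let L13 : L [set i1; i3]%SET = - (x3 * (2 * rconst b * x2 + rconst a * x1)).
Proof. by rewrite LE //=; ring. Qed.
Let L23 : L [set i2; i3]%SET = x3 * (2 * rconst b * x1 - rconst a * x2).
Proof. by rewrite LE //=; ring. Qed.

(** Up to sign, the Hamiltonian vector field of a function with gradient d. The set {i, j} forgets
    the order of its elements, so the antisymmetry of L is carried by the sign (-1)^(i < j). *)
Let ham (d : 'I_3 -> ratfun R) j : ratfun R :=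
  \sum_i (if i == j then 0 else (-1) ^+ (i < j)%N * L [set i; j]%SET) * d i.

Let ham_schouten f j : schouten L (f *: one R) [set j]%SET = ham (fun i => pderiv i f) j.
Proof.
rewrite schouten_fun; apply: eq_bigr => i _; congr (_ * _).
by rewrite rderivE finset.in_set1; case: eqP => // _; rewrite shuffle_sign1.
Qed.

Let sum3 (F : 'I_3 -> ratfun R) : \sum_i F i = F i1 + F i2 + F i3.
Proof.
rewrite !big_ord_recl big_ord0 addr0 addrA.
by congr (F _ + F _ + F _); apply: val_inj.
Qed.

Let L21 : L [set i2; i1]%SET = L [set i1; i2]%SET.
Proof. by rewrite finset.setUC. Qed.
Let L31 : L [set i3; i1]%SET = L [set i1; i3]%SET.
Proof. by rewrite finset.setUC. Qed.
Let L32 : L [set i3; i2]%SET = L [set i2; i3]%SET.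
Proof. by rewrite finset.setUC. Qed.

Let hamE d : [/\
  ham d i1 = rconst b * E * d i2 - x3 * (2 * rconst b * x2 + rconst a * x1) * d i3,
  ham d i2 = - (rconst b * E * d i1) + x3 * (2 * rconst b * x1 - rconst a * x2) * d i3
  & ham d i3 = x3 * (2 * rconst b * x2 + rconst a * x1) * d i1
               - x3 * (2 * rconst b * x1 - rconst a * x2) * d i2].
Proof.
by split; rewrite /ham sum3 /= ?L21 ?L31 ?L32 ?L12 ?L13 ?L23; ring.
Qed.

(** These are the coefficients of [L, f] along d/dx2 and d/dx1, in this order. *)
Lemma cocycle_equations f : schouten L (f *: one R) = 0 ->
  rconst b * E * pderiv i1 f
    = x3 * (2 * rconst b * x1 - rconst a * x2) * pderiv i3 f /\
  rconst b * E * pderiv i2 f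
    = x3 * (2 * rconst b * x2 + rconst a * x1) * pderiv i3 f.
Proof.
move=> Lf0; have ham0 j : ham (fun i => pderiv i f) j = 0.
  by rewrite -ham_schouten Lf0 ffunE.
have [h1 h2 _] := hamE (fun i => pderiv i f); split; apply/eqP; rewrite -subr_eq0.
  by rewrite -oppr_eq0 opprB addrC -h2 ham0.
by rewrite -h1 ham0.
Qed.

(** The bracket is linear in the gradient, so [L, f] = w [L, D]; the terms in b cancel in [L, D],
    leaving a factor a w in every coefficient. The case w = 0 serves the constants. *)
Lemma cocycle_of_gradient f w : a = 0 \/ w = 0 ->
  (forall i, pderiv i f = w * pderiv i D) -> schouten L (f *: one R) = 0.
Proof.
move=> aw df; apply/ffunP => I; apply: etrans _ (esym (ffunE _ _)).
have [/eqP/cards1P [j ->]|I1] := eqVneq #|I| 1%N; last first.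
  rewrite schouten_fun big1 // => i _; rewrite rderivE.
  case: ifPn => [_|iI]; first by rewrite mul0r.
  by rewrite L_homogeneous ?mulr0 ?mul0r // cardsU1 iI add1n eqSS.
rewrite ham_schouten.
have [[dD1 dM1 _] [dD2 dM2 _] [dD3 dM3 _]] :=
  And3 (pderivP R i1) (pderivP R i2) (pderivP R i3).
have E1 : pderiv i1 f = w * (2 * x1 * x3).
  by rewrite df /D /Dfun !expr2 !(dD1, dM1) !pderiv_coord /=; ring.
have E2 : pderiv i2 f = w * (2 * x2 * x3).
  by rewrite df /D /Dfun !expr2 !(dD2, dM2) !pderiv_coord /=; ring.
have E3 : pderiv i3 f = w * E.
  by rewrite df /D /E /Dfun !expr2 !(dD3, dM3) !pderiv_coord /=; ring.
have aw0 : rconst a * w = 0.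
  by case: aw => ->; rewrite ?rmorph0 ?mul0r ?mulr0.
have [h1 h2 h3] := hamE (fun i => pderiv i f); move: h1 h2 h3; rewrite /= E1 E2 E3 => h1 h2 h3.
have [-> | -> | ->] : [\/ j = i1, j = i2 | j = i3].
  by case: j => [[|[|[|//]]]] ?; [apply: Or31|apply: Or32|apply: Or33]; exact: val_inj.
- transitivity (- (x3 * x1 * E) * (rconst a * w)); last by rewrite aw0 mulr0.
  by rewrite h1 /E; ring.
- transitivity (- (x3 * x2 * E) * (rconst a * w)); last by rewrite aw0 mulr0.
  by rewrite h2 /E; ring.
- transitivity (2 * x3 ^+ 2 * E * (rconst a * w)); last by rewrite aw0 mulr0.
  by rewrite h3 /E; ring.
Qed.

End FunctionCocycles.

(** * Cochains as polynomials in t = x1 / x2 *)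

Lemma expf_horner_div (F K : fieldType) (phi : {rmorphism F -> K}) (x y : K)
    (p : {poly F}) (k : nat) : y != 0 -> (size p <= k.+1)%N ->
  y ^+ k * (map_poly phi p).[x / y] =
  \sum_(l < k.+1) phi p`_l * x ^+ l * y ^+ (k - l).
Proof.
move=> y_neq0 size_p; rewrite (@horner_coef_wide _ k.+1) ?size_map_poly //.
rewrite mulr_sumr; apply: eq_bigr => l _; rewrite coef_map /= exprMn exprVn.
have -> : y ^+ k = y ^+ (k - l) * y ^+ l by rewrite -exprD subnK // -ltnS.
rewrite [LHS](_ : _ = phi p`_l * x ^+ l * y ^+ (k - l) * (y ^+ l / y ^+ l)).
  by rewrite divff ?expf_neq0 ?mulr1.
by ring.
Qed.

Section Cochains.

Variable R : realType.
Implicit Types (p : {poly R}) (v : mvf R) (f : ratfun R).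

Local Notation x1 := (coord R i1).
Local Notation x2 := (coord R i2).
Local Notation x3 := (coord R i3).
Local Notation D := (Dfun R).
Local Notation "p ^r" := (map_poly (@rconst R) p) (at level 2, format "p ^r").

(** Clearing denominators turns a relation for x1 / x2 into a vanishing polynomial in x1 and x2;
    substituting X for x1 and 1 for x2 recovers p from it. *)
Lemma coord_transc p : p^r.[x1 / x2] = 0 -> p = 0.
Proof.
move=> p0; have size_p : (size p <= (size p).+1)%N by [].
have := expf_horner_div (@rconst R) x1 (coord_neq0 R i2) size_p.
rewrite p0 mulr0 => /esym.
pose h (i : 'I_3) : {poly R} := if i == i1 then 'X else 1.
pose q : {mpoly R[3]} :=
  \sum_(l < (size p).+1) (p`_l)%:MP * 'X_i1 ^+ l * 'X_i2 ^+ (size p - l).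
have -> : \sum_(l < (size p).+1) rconst p`_l * x1 ^+ l * x2 ^+ (size p - l)
    = tofrac q.
  rewrite /q rmorph_sum; apply: eq_bigr => l _.
  by rewrite !rmorphM !rmorphXn.
move/eqP; rewrite tofrac_eq0 => /eqP /(congr1 (mmap (@polyC R) h)).
rewrite rmorph0 rmorph_sum /= => <-.
(* Homogenising in degree [size p], one above the degree of a nonzero p, adds a last term whose
   coefficient is 0. *)
rewrite -[LHS]coefK poly_def [RHS]big_ord_recr /= nth_default // mpolyC0 !mul0r.
rewrite rmorph0 addr0; apply: eq_bigr => l _.
rewrite !rmorphM !rmorphXn /= mmapC !mmapX !mmap1U /h /= expr1n mulr1.
by rewrite mul_polyC.
Qed.

Lemma PpolyP k r f : Ppoly k r f <->
  exists2 p : {poly R}, (size p <= k.+1)%N & f = x2 ^+ k * x3 ^+ (r - k) * p^r.[x1 / x2].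
Proof.
split=> [[c ->]|[p size_p ->]].
  exists (\poly_(l < k.+1) c (inord l)); first exact: size_poly.
  rewrite mulrAC expf_horner_div ?coord_neq0 ?size_poly // mulr_suml.
  by apply: eq_bigr => l _; rewrite coef_poly ltn_ord inord_val.
exists (fun l : 'I_k.+1 => p`_l).
by rewrite mulrAC expf_horner_div ?coord_neq0 // mulr_suml.
Qed.

Lemma DfunE : D = x2 ^+ 2 * x3 * (1 + 'X^2)^r.[x1 / x2].
Proof.
rewrite /Dfun (add_sqr_horner (@rconst R) _ (coord_neq0 R i2)).
by rewrite mulrAC.
Qed.

Lemma Dfun_neq0 : D != 0.
Proof.
rewrite DfunE !mulf_neq0 ?expf_neq0 ?coord_neq0 //; apply/eqP => /coord_transc /eqP.
by rewrite -size_poly_eq0 size_1_addX2.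
Qed.

Lemma Pcochain0P k r v : Pcochain 0 k r v -> v = 0 \/ exists f,
  [/\ (2 <= k)%N, (k < r)%N, Ppoly k r f & v = (f / D) *: one R].
Proof.
rewrite /Pcochain /when; case: ifP => [/and3P [k2 r3 kr]|_ ->]; last by left.
by case=> _ [f Pf <-] <-; right; exists f; split=> //; lia.
Qed.

(** Writing f as (f D) / D, multiplication by D raises the bidegree by (2, 3) and multiplies the
    polynomial in t by 1 + X^2. *)
Lemma Rcochain0_sub k r : (@Rcochain R 0 k r `<=` Pcochain 0 k r).
Proof.
rewrite /Rcochain /Pcochain /when; case: ifP => [/and3P [k2 r3 kr]|_] v //.
case=> f /PpolyP [p size_p fE] <-; exists f => //; exists (f * D); last first.
  by rewrite mulfK ?Dfun_neq0.
apply/PpolyP; exists ((1 + 'X^2) * p).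
  apply: leq_trans (size_polyMleq _ _) _.
  by rewrite size_1_addX2 (_ : k.+1 = 2 + (k - 2).+1)%N ?leq_add2l; lia.
rewrite fE DfunE rmorphM hornerM.
have -> : (r - 3 - (k - 2) = (r - k).-1)%N by lia.
have -> : x2 ^+ k = x2 ^+ (k - 2) * x2 ^+ 2 by rewrite -exprD subnK.
have -> : x3 ^+ (r - k) = x3 ^+ (r - k).-1 * x3 by rewrite -exprSr prednK //; lia.
by ring.
Qed.

Lemma Rcochain0_D m c :
  Rcochain 0 (2 * m.+1) (3 * m.+1) ((rconst c * D ^+ m) *: one R).
Proof.
rewrite /Rcochain /when ifT; last by apply/and3P; split; lia.
exists (rconst c * D ^+ m) => //; apply/PpolyP; exists (c *: (1 + 'X^2) ^+ m).
  apply: leq_trans (size_scale_leq _ _) _; apply: leq_trans (size_poly_exp_leq _ _) _.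
  by rewrite size_1_addX2 /=; lia.
have -> : (2 * m.+1 - 2 = 2 * m)%N by lia.
have -> : (3 * m.+1 - 3 - 2 * m = m)%N by lia.
by rewrite map_polyZ hornerZ rmorphXn /= horner_exp DfunE !exprMn mulnC exprM; ring.
Qed.

Lemma Rcochain0_0 k r : Rcochain 0 k r (0 : mvf R).
Proof.
rewrite /Rcochain /when; case: ifP => // _; exists 0; last by rewrite scale0r.
apply/PpolyP; exists 0; first by rewrite size_poly0.
by rewrite rmorph0 horner0 mulr0.
Qed.

Variables (a b : R).
Hypothesis b_neq0 : b != 0.

Let L : mvf R := rconst b *: wedge (Y1 R) (Y2 R)
         + rconst (2%:R * b) *: wedge (Y2 R) (Y3 R)
         + rconst a *: wedge (Y3 R) (Y1 R).

Lemma cocycle0_classification k r v : Pcochain 0 k r v -> schouten L v = 0 ->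
  v = 0 \/ exists m c, [/\ k = (2 * m.+1)%N, r = (3 * m.+1)%N,
    v = (rconst c * D ^+ m) *: one R & a = 0 \/ m = 0%N].
Proof.
move=> /Pcochain0P [->|[f [k2 kr /PpolyP [p _ fE] ->]]]; first by left.
have [p0 _|p_neq0] := eqVneq p 0.
  by left; rewrite fE p0 rmorph0 horner0 mulr0 mul0r scale0r.
case/cocycle_equations; rewrite fE => eq1 eq2; right.
have [|||m [c [kE rE gE am]]] := potential_cocycle (pderivP R i1) (pderivP R i2)
  (pderivP R i3) _ _ _ coord_transc (coord_neq0 R i2) (coord_neq0 R i3)
  b_neq0 p_neq0 eq1 eq2; try by rewrite !pderiv_coord.
(* The bound k >= 2 excludes m = 0, that is f = c / D; the index then shifts by one. *)
case: m => [|m] in kE rE gE am *; first by lia.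
exists m, c; split; [lia | lia | | by case: am => [|[->]]; [left|right]].
by rewrite gE exprSr mulrA mulfK ?Dfun_neq0.
Qed.

Lemma cocycle0_D m c : a = 0 \/ m = 0%N ->
  schouten L ((rconst c * D ^+ m) *: one R) = 0.
Proof.
(* The chain rule gives w = m c D^(m-1); at m = 0 the truncated exponent is harmless because the
   factor m vanishes. *)
move=> am; apply: (@cocycle_of_gradient R a b _ (m%:R * rconst c * D ^+ m.-1)).
  by case: am => [|->]; [left | right; rewrite !mul0r].
move=> i; have [_ dM dC] := pderivP R i.
have dX n : pderiv i (D ^+ n) = n%:R * D ^+ n.-1 * pderiv i D.
  elim: n => [|n IHn]; first by rewrite expr0 -(rmorph1 (@rconst R)) dC !mul0r.
  rewrite exprS dM IHn; case: n {IHn} => [|n] /=; first by rewrite expr0; ring.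
  by rewrite exprS [n.+2%:R]mulrS; ring.
by rewrite dM dC dX; ring.
Qed.

Lemma cocycle0_0 : schouten L 0 = 0.
Proof.
have := @cocycle0_D 0 0 (or_intror erefl).
by rewrite rmorph0 mul0r scale0r.
Qed.

End Cochains.

(** * Cocycles of the total complexes and of their graded parts *)

Section FormalSums.

Variable R : realType.

Lemma formal_sum0 (I : set (nat * nat)) :
  formal_sum I (fun _ _ => [set (0 : mvf R)]) = [set (0 : fcochain R)].
Proof.
apply/seteqP; split=> [u Iu|_ -> k r]; last by [].
apply/funext => k; apply/funext => r; have [uI uIN] := Iu k r.
by have [/uI|/uIN] := pselect (I (k, r)).
Qed.

(** With zero coboundaries, as in degree 0, comparing cohomology spaces amounts to comparing sets of
    cocycles; [represents_cycles] is used in the same way. *)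
Lemma coincide_of_eq (V : zmodType) (S : set V) (H H' : subquotient V) :
  cycles H = S -> cycles H' = S ->
  boundaries H = [set 0] -> boundaries H' = [set 0] -> coincide H H'.
Proof.
move=> zH zH' bH bH'; split; rewrite ?zH ?zH' ?bH ?bH' //.
by move=> z Sz; exists z; rewrite ?subrr.
Qed.

Lemma represents_cycles (V : zmodType) (H : subquotient V) :
  boundaries H = [set 0] -> represents (cycles H) H.
Proof.
move=> bH; split=> // z zH; exists z; rewrite bH; split=> [|s [_ /subr0_eq //]].
by split=> //; exact: subrr.
Qed.

Variables (a b : R).
Hypothesis b_neq0 : b != 0.

Let L : mvf R := rconst b *: wedge (Y1 R) (Y2 R)
         + rconst (2%:R * b) *: wedge (Y2 R) (Y3 R)
         + rconst a *: wedge (Y3 R) (Y1 R).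
Local Notation D := (Dfun R).

Definition formal_cocycles (I : set (nat * nat)) : set (fcochain R) :=
  [set u | forall k r, u k r = 0 \/ exists m c,
     [/\ k = (2 * m.+1)%N, r = (3 * m.+1)%N, I (k, r)
       & u k r = (rconst c * D ^+ m) *: one R]].

Variables (C : nat -> nat -> nat -> set (mvf R)) (I : set (nat * nat)).
Hypotheses (RC : forall k r, Rcochain 0 k r `<=` C 0 k r)
           (CP : forall k r, C 0 k r `<=` Pcochain 0 k r).
Hypothesis IP : forall m, I ((2 * m.+1)%N, (3 * m.+1)%N) <-> a = 0 \/ m = 0%N.

(** The family C is later taken to be [Rcochain] or [Pcochain]. The classification holds for all
    potential cochains and its solutions c D^m are real, so everything in between has the same
    cocycles; by [IP], I selects the bidegrees where D^m is one. *)
Let cocycleP k r v : C 0 k r v /\ schouten L v = 0 <->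
  v = 0 \/ exists m c, [/\ k = (2 * m.+1)%N, r = (3 * m.+1)%N, I (k, r)
    & v = (rconst c * D ^+ m) *: one R].
Proof.
split=> [[/CP Pv Lv0]|[->|[m [c [-> -> /IP am ->]]]]].
- have [->|[m [c [kE rE vE am]]]] := cocycle0_classification b_neq0 Pv Lv0.
    by left.
  by right; exists m, c; split=> //; rewrite kE rE; apply/IP.
- by split; [apply: RC; exact: Rcochain0_0 | exact: cocycle0_0].
- by split; [apply: RC; exact: Rcochain0_D | exact: cocycle0_D].
Qed.

Lemma cycles_total_cohomology :
  cycles (total_cohomology L C 0) = formal_cocycles I.
Proof.
apply/seteqP; split=> u.
  move=> [Cu Lu] k r; apply/cocycleP; split; first by have [/(_ Logic.I)] := Cu k r.
  exact: (congr1 (fun w : fcochain R => w k r) Lu).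
move=> Zu; split.
  by move=> k r; split=> [_|/(_ Logic.I) //]; have /cocycleP [] := Zu k r.
by apply/funext => k; apply/funext => r; have /cocycleP [] := Zu k r.
Qed.

Lemma cycles_sum_cohomology :
  cycles (sum_cohomology L C 0 I) = formal_cocycles I.
Proof.
apply/seteqP; split=> u.
  move=> Iu k r; have [uI uIN] := Iu k r.
  have [kr|/uIN ->] := pselect (I (k, r)); last by left.
  by apply/cocycleP; exact: uI.
move=> Zu k r; split=> [_|kr]; first exact/cocycleP/Zu.
by have [|[m [c [_ _ /kr]]]] := Zu k r.
Qed.

End FormalSums.

(** * Constants and power series in D as explicit cocycles *)

Section Representatives.

Variable R : realType.

Lemma formal_cocycles_constants :
  formal_cocycles [set (2%N, 3%N)] = @constants R.
Proof.
apply/seteqP; split=> [u Zu|_ [c ->] k r].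
  have [c uE] : exists c, u 2%N 3%N = rconst c *: one R.
    have [->|[m [c [m0 _ _ ->]]]] := Zu 2%N 3%N.
      by exists 0; rewrite rmorph0 scale0r.
    by exists c; rewrite (_ : m = 0%N) ?expr0 ?mulr1 //; lia.
  exists c; apply/funext => k; apply/funext => r; rewrite /in_bidegree.
  case: ifP => [/andP [/eqP -> /eqP ->] //|kr].
  have [//|[m [c' [_ _ [k2 r3] _]]]] := Zu k r.
  by rewrite k2 r3 in kr.
rewrite /in_bidegree; case: ifP => [/andP [/eqP -> /eqP ->]|_]; last by left.
by right; exists 0%N, c; rewrite expr0 mulr1.
Qed.

Lemma Dseries_eq0 (c : nat -> R) k r :
  (forall m, (k, r) <> ((2 * m.+1)%N, (3 * m.+1)%N)) -> Dseries c k r = 0.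
Proof.
move=> kr; rewrite /Dseries big1 // => m _; rewrite /in_bidegree.
by case: ifP => // /andP [/eqP k2 /eqP r3]; case: (kr m); congr pair.
Qed.

Lemma DseriesE (c : nat -> R) m :
  Dseries c (2 * m.+1)%N (3 * m.+1)%N = (rconst (c m) * Dfun R ^+ m) *: one R.
Proof.
(* The truncation of [Dseries] at k = 2 (m + 1) retains the m-th term. *)
have m_lt : (m < 2 * m.+1)%N by lia.
rewrite /Dseries (bigD1 (Ordinal m_lt)) //= big1 => [|i /negP im].
  by rewrite /in_bidegree !eqxx addr0.
rewrite /in_bidegree; case: ifP => // /andP [/eqP mi _]; case: im.
by apply/eqP/val_inj => /=; lia.
Qed.

Lemma formal_cocycles_Dseries :
  formal_cocycles
    [set ((2 * k)%N, (3 * k)%N) | k in [set k | (1 <= k)%N]] =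
  [set Dseries c | c in [set: nat -> R]].
Proof.
apply/seteqP; split=> [u Zu|_ [c _ <-] k r].
  (* Choice gathers the coefficients from all bidegrees into one sequence. *)
  have /choice [c uE] m : exists c, u (2 * m.+1)%N (3 * m.+1)%N =
      (rconst c * Dfun R ^+ m) *: one R.
    have [->|[n [c [nE _ _ ->]]]] := Zu (2 * m.+1)%N (3 * m.+1)%N.
      by exists 0; rewrite rmorph0 mul0r scale0r.
    by exists c; rewrite (_ : m = n) //; lia.
  exists c => //; apply/funext => k; apply/funext => r.
  have [[m [-> ->]]|kr] := pselect (exists m, (k, r) = ((2 * m.+1)%N, (3 * m.+1)%N)).
    by rewrite DseriesE uE.
  rewrite Dseries_eq0; last by move=> m krE; apply: kr; exists m.
  by have [//|[m [_ [kE rE _ _]]]] := Zu k r; case: kr; exists m; rewrite kE rE.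
have [[m [-> ->]]|kr] := pselect (exists m, (k, r) = ((2 * m.+1)%N, (3 * m.+1)%N)).
  right; exists m, (c m); split=> //; last exact: DseriesE.
  by exists m.+1.
by left; apply: Dseries_eq0 => m krE; apply: kr; exists m.
Qed.

End Representatives.

Theorem theorem1 (R : realType) (a b : R) (hb : b != 0) :
  let L : mvf R := rconst b *: wedge (Y1 R) (Y2 R)
         + rconst (2%:R * b) *: wedge (Y2 R) (Y3 R)
         + rconst a *: wedge (Y3 R) (Y1 R) in
  let H0P := total_cohomology L (@Pcochain R) 0 in
  let H0R := total_cohomology L (@Rcochain R) 0 in
  let sumP := sum_cohomology L (@Pcochain R) 0 in
  let sumR := sum_cohomology L (@Rcochain R) 0 in
  coincide H0R H0P
  /\ (a != 0 ->
      let I : set (nat * nat) := [set (2%N, 3%N)] in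
      [/\ coincide (sumP I) H0P,
          coincide (sumR I) H0R &
          [/\ represents (@constants R) H0P,
              represents (@constants R) H0R,
              represents (@constants R) (sumP I)
            & represents (@constants R) (sumR I)]])
  /\ (a = 0 ->
      let I : set (nat * nat) := 
        [set ((2 * k)%N, (3 * k)%N) | k in [set k | (1 <= k)%N]] in
      let RD : set (fcochain R) := [set Dseries c | c in [set: nat -> R]] in
      [/\ coincide (sumP I) H0P,
          coincide (sumR I) H0R &
          [/\ represents RD H0P,
              represents RD H0R,
              represents RD (sumP I)
            & represents RD (sumR I)]]).
Proof.
move=> L H0P H0R sumP sumR.
have bS C I : boundaries (sum_cohomology L C 0 I) = [set 0] := formal_sum0 R I.
have RP := @Rcochain0_sub R.
have all_eq (I : set (nat * nat)) :
    (forall m, I ((2 * m.+1)%N, (3 * m.+1)%N) <-> a = 0 \/ m = 0%N) ->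
    let Z := formal_cocycles I in
    [/\ cycles H0P = Z, cycles H0R = Z, cycles (sumP I) = Z & cycles (sumR I) = Z].
  move=> IP; split.
  - exact: (cycles_total_cohomology hb RP (fun _ _ _ => id)).
  - exact: (cycles_total_cohomology hb (fun _ _ _ => id) RP).
  - exact: (cycles_sum_cohomology hb RP (fun _ _ _ => id)).
  - exact: (cycles_sum_cohomology hb (fun _ _ _ => id) RP).
have rep (S : set (fcochain R)) H : cycles H = S -> boundaries H = [set 0] ->
    represents S H.
  by move=> <-; exact: represents_cycles.
have coin (I : set (nat * nat)) :
    (forall m, I ((2 * m.+1)%N, (3 * m.+1)%N) <-> a = 0 \/ m = 0%N) ->
    [/\ coincide H0R H0P, coincide (sumP I) H0P, coincide (sumR I) H0R &
        [/\ represents (formal_cocycles I) H0P, represents (formal_cocycles I) H0R,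
            represents (formal_cocycles I) (sumP I)
          & represents (formal_cocycles I) (sumR I)]].
  move=> /all_eq [zP zR zsP zsR].
  split; [exact: (coincide_of_eq zR zP) | exact: (coincide_of_eq zsP zP (bS _ _))
    | exact: (coincide_of_eq zsR zR (bS _ _)) | split].
  - exact: rep zP _.
  - exact: rep zR _.
  - exact: rep zsP (bS _ _).
  - exact: rep zsR (bS _ _).
have IPa : a != 0 -> forall m,
    [set (2%N, 3%N)] ((2 * m.+1)%N, (3 * m.+1)%N) <-> a = 0 \/ m = 0%N.
  move=> a_neq0 m; split=> [[m0 _]|[a0|-> //]]; first by right; lia.
  by rewrite a0 eqxx in a_neq0.
have IP0 : a = 0 -> forall m,
    [set ((2 * k)%N, (3 * k)%N) | k in [set k | (1 <= k)%N]]
      ((2 * m.+1)%N, (3 * m.+1)%N) <-> a = 0 \/ m = 0%N.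
  by move=> a0 m; split=> _; [left | exists m.+1].
split; last split.
(* This claim does not mention I; the case split on a only supplies an index set to which [coin]
   applies. *)
- by have [/IP0|/IPa] := eqVneq a 0; case/coin.
- move=> /IPa /coin [_ cP cR reps] I; split; [exact: cP | exact: cR|].
  by rewrite -formal_cocycles_constants.
- move=> /IP0 /coin [_ cP cR reps] I RD; split; [exact: cP | exact: cR|].
  by rewrite /RD -formal_cocycles_Dseries.
Qed.
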